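(* Let $T>0$, $0<\eta<T$, $0<\alpha<\frac{1}{\eta}$, let $f\in C([0,\infty),[0,\infty))$, and let $a\in C([0,T],[0,\infty))$ with $a(t_0)>0$ for some $t_0\in[0,T]$. Consider the boundary value problem \[ u''(t)+a(t)f(u(t))=0,\quad 0<t<T,\qquad u'(0)=0,\quad u(T)=\alpha\int_0^{\eta}u(s)\,ds. \tag{P} \] Suppose that either (i) $f_0=0$ and $f_\infty=\infty$, or (ii) $f_0=\infty$ and $f_\infty=0$. Then (P) has at least one positive solution.
   Context: $f_0=\lim_{u\to0^+}\frac{f(u)}{u}$ and $f_\infty=\lim_{u\to\infty}\frac{f(u)}{u}$ (these limits are assumed to exist in $[0,\infty]$ with the stated values). A positive solution of (P) is a function $u\in C^2([0,T])$ satisfying (P) with $u(t)\ge0$ on $[0,T]$ and $u$ not identically zero. *)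

(* Defs.v *)
From Stdlib Require Import Reals.
From Coquelicot Require Import Coquelicot.
Open Scope R_scope.

Definition cont_on (D : R -> Prop) (g : R -> R) : Prop :=
  forall x, D x -> filterlim g (within D (locally x)) (locally (g x)).

(* u is of class C^2 on [0,T]: u is taken as a function on R that is
   differentiable everywhere, whose derivative is differentiable at every
   point of [0,T], and whose second derivative is continuous on [0,T]
   (relative to [0,T]).  (Any C^2 function on [0,T] extends to such a
   function, so this is the same class on [0,T].) *)
Definition C2_on (T : R) (u : R -> R) : Prop :=
  (forall t, ex_derive u t) /\
  (forall t, 0 <= t <= T -> ex_derive (Derive u) t) /\
  cont_on (fun t => 0 <= t <= T) (Derive_n u 2).

Definition solves_P (T eta alpha : R) (a f : R -> R) (u : R -> R) : Prop :=
  C2_on T u /\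
  (forall t, 0 < t < T -> Derive_n u 2 t + a t * f (u t) = 0) /\
  Derive u 0 = 0 /\
  ex_RInt u 0 eta /\
  u T = alpha * RInt u 0 eta.

Definition positive_solution (T eta alpha : R) (a f : R -> R) (u : R -> R) : Prop :=
  solves_P T eta alpha a f u /\
  (forall t, 0 <= t <= T -> 0 <= u t) /\
  (exists t, 0 <= t <= T /\ u t <> 0).

Definition f_zero_lim (f : R -> R) (l : Rbar) : Prop :=
  filterlim (fun x => f x / x) (at_right 0) (Rbar_locally l).
Definition f_inf_lim (f : R -> R) (l : Rbar) : Prop :=
  filterlim (fun x => f x / x) (Rbar_locally p_infty) (Rbar_locally l).

(* Main.v *)
(** Shooting for a delayed equation. Fix an initial height c and solve
    u'' = - a(t) f(u(t - h)), u(0) = c, u'(0) = 0: for h > 0 this is a finite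
    recursion, so u depends continuously on c although f is only continuous.
    The solution is decreasing and concave.  Put
    Phi(c) = u(T) - alpha * int_0^eta u.  If f <= e c on [0, c] with e small then
    Phi(c) > 0.  If Phi(c) >= 0, concavity forces u >= gamma c on [0, T] with
    gamma = alpha eta (1 - eta / T), so f >= m c on [gamma c, c] with m large would
    give u(T) < 0; hence Phi(c) < 0 for such c.  The growth conditions at 0 and at
    infinity provide a c of each kind, independent of h, and the intermediate value
    theorem gives Phi(c) = 0.  The resulting functions are bounded and
    equi-Lipschitz, and a uniform cluster point as h -> 0 solves the problem. *)

Require Import Defs.
From Stdlib Require Import Reals Lra Lia ClassicalEpsilon.
From Coquelicot Require Import Coquelicot.
Open Scope R_scope.

(** * Truncation to an interval, and continuity in epsilon-delta form *)

Definition clamp (b x : R) : R := Rmax 0 (Rmin b x).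

Lemma clamp_range (b x : R) : 0 <= b -> 0 <= clamp b x <= b.
Proof.
intros Hb; unfold clamp, Rmax, Rmin.
repeat destruct Rle_dec; lra.
Qed.

Lemma clamp_id (b x : R) : 0 <= x <= b -> clamp b x = x.
Proof.
intros Hx; unfold clamp, Rmax, Rmin.
repeat destruct Rle_dec; lra.
Qed.

Lemma clamp_lip (b x y : R) : Rabs (clamp b x - clamp b y) <= Rabs (x - y).
Proof.
unfold clamp, Rmax, Rmin.
repeat destruct Rle_dec; unfold Rabs; repeat destruct Rcase_abs; lra.
Qed.

Lemma continuous_eps (g : R -> R) (x : R) :
  continuous g x <->
  forall eps, 0 < eps -> exists d, 0 < d /\
    forall y, Rabs (y - x) < d -> Rabs (g y - g x) < eps.
Proof.
split.
- intros H eps He.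
  destruct (proj1 (filterlim_locally g (g x)) H (mkposreal eps He)) as [d Hd].
  exists d; split; [apply cond_pos|].
  intros y Hy; exact (Hd y Hy).
- intros H; apply filterlim_locally; intros eps.
  destruct (H eps (cond_pos eps)) as [d [Hd0 Hd]].
  exists (mkposreal d Hd0); intros y Hy; exact (Hd y Hy).
Qed.

Lemma lipschitz_continuous (g : R -> R) (L x : R) :
  0 <= L -> (forall s t, Rabs (g s - g t) <= L * Rabs (s - t)) -> continuous g x.
Proof.
intros HL H; apply continuous_eps; intros eps He.
exists (eps / (L + 1)); split; [apply Rdiv_lt_0_compat; lra|].
intros y Hy; apply Rle_lt_trans with (1 := H y x).
apply Rle_lt_trans with ((L + 1) * Rabs (y - x)).
- assert (H0 := Rabs_pos (y - x)); nra.
- replace eps with ((L + 1) * (eps / (L + 1))) by (field; lra).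
  apply Rmult_lt_compat_l; lra.
Qed.

(** Turns relative continuity into continuity on all of R. With [p] a [clamp], the data [a] and [f],
    whose values outside their domains are arbitrary, get replaced by globally continuous
    functions. *)
Lemma cont_on_comp (D : R -> Prop) (g p : R -> R) :
  cont_on D g -> (forall x, D (p x)) ->
  (forall s t, Rabs (p s - p t) <= Rabs (s - t)) ->
  forall x, continuous (fun x => g (p x)) x.
Proof.
intros Hg Hp Hl x; apply continuous_eps; intros eps He.
destruct (proj1 (filterlim_locally g (g (p x))) (Hg (p x) (Hp x)) (mkposreal eps He))
  as [d Hd].
exists d; split; [apply cond_pos|].
intros y Hy; apply (Hd (p y)); [|apply Hp].
exact (Rle_lt_trans _ _ _ (Hl y x) Hy).
Qed.

(** Heine's theorem on [0, b] carries over to R because [clamp] is a 1-Lipschitz retraction onto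
    [0, b]. *)
Lemma clamp_comp_uniform_continuous (g : R -> R) (b : R) :
  0 <= b -> (forall x, continuous (fun x => g (clamp b x)) x) ->
  forall eps, 0 < eps -> exists d, 0 < d /\
    forall x y, Rabs (x - y) < d -> Rabs (g (clamp b x) - g (clamp b y)) < eps.
Proof.
intros Hb Hg eps He.
assert (Hu : uniform_continuity (fun x => g (clamp b x)) (fun x => 0 <= x <= b)).
{ apply Heine; [apply compact_P3|].
  intros x _; apply continuity_pt_filterlim, Hg. }
destruct (Hu (mkposreal eps He)) as [d Hd].
exists d; split; [apply cond_pos|].
intros x y Hxy.
assert (H := Hd (clamp b x) (clamp b y) (clamp_range b x Hb) (clamp_range b y Hb)
  (Rle_lt_trans _ _ _ (clamp_lip b x y) Hxy)).
simpl in H.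
rewrite !(clamp_id b (clamp b _)) in H by (apply clamp_range, Hb).
exact H.
Qed.

Lemma clamp_comp_bounded (g : R -> R) (b : R) :
  0 <= b -> (forall x, continuous (fun x => g (clamp b x)) x) ->
  exists M, 0 < M /\ forall x, g (clamp b x) <= M.
Proof.
intros Hb Hg.
destruct (continuity_ab_maj (fun x => g (clamp b x)) 0 b Hb) as [m [Hm _]].
{ intros x _; apply continuity_pt_filterlim, Hg. }
exists (Rmax 1 (g (clamp b m))); split.
- apply Rlt_le_trans with 1; [lra | apply Rmax_l].
- intros x; apply Rle_trans with (2 := Rmax_r _ _).
  assert (H := Hm (clamp b x) (clamp_range b x Hb)).
  rewrite (clamp_id b (clamp b x)) in H by (apply clamp_range, Hb).
  exact H.
Qed.

(** * Iterated integrals *)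

Lemma ex_RInt_cont (g : R -> R) (a b : R) :
  (forall x, continuous g x) -> ex_RInt g a b.
Proof. intros Hg; apply (ex_RInt_continuous g); intros; apply Hg. Qed.

Lemma RInt_split (g : R -> R) (a b c : R) :
  (forall x, continuous g x) -> RInt g a c = RInt g a b + RInt g b c.
Proof.
intros Hg; symmetry; apply (RInt_Chasles g a b c); apply ex_RInt_cont, Hg.
Qed.

Lemma RInt_bounds (g : R -> R) (a b m M : R) :
  (forall x, continuous g x) -> a <= b ->
  (forall x, a < x < b -> m <= g x <= M) ->
  m * (b - a) <= RInt g a b <= M * (b - a).
Proof.
intros Hg Hab H.
assert (Hc : forall k : R, RInt (fun _ => k) a b = k * (b - a)).
{ intros k; rewrite RInt_const; unfold scal; simpl; unfold mult; simpl; ring. }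
rewrite <- !Hc; split; apply RInt_le; trivial;
  try (apply ex_RInt_cont; trivial; intros; apply continuous_const);
  intros x Hx; apply H, Hx.
Qed.

Lemma RInt_dist (g1 g2 : R -> R) (a b eps : R) :
  (forall x, continuous g1 x) -> (forall x, continuous g2 x) -> a <= b ->
  (forall x, a <= x <= b -> Rabs (g1 x - g2 x) <= eps) ->
  Rabs (RInt g1 a b - RInt g2 a b) <= (b - a) * eps.
Proof.
intros H1 H2 Hab H.
change (RInt g1 a b - RInt g2 a b) with (minus (RInt g1 a b) (RInt g2 a b)).
rewrite <- RInt_minus by (apply ex_RInt_cont; trivial).
apply abs_RInt_le_const; trivial.
apply ex_RInt_cont; intros x.
apply (continuous_minus g1 g2); trivial.
Qed.

Lemma RInt_cont_derive (g : R -> R) (a t : R) :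
  (forall x, continuous g x) -> is_derive (fun s => RInt g a s) t (g t).
Proof.
intros Hg; apply (is_derive_RInt g _ a t); [|apply Hg].
apply filter_forall; intros s; apply (RInt_correct g a s), ex_RInt_cont, Hg.
Qed.

Lemma RInt_cont_continuous (g : R -> R) (a : R) :
  (forall x, continuous g x) -> forall t, continuous (fun s => RInt g a s) t.
Proof.
intros Hg t; apply (ex_derive_continuous (fun s => RInt g a s)).
exists (g t); apply RInt_cont_derive, Hg.
Qed.

Lemma RInt_pos_subinterval (g : R -> R) (p q b : R) :
  (forall x, continuous g x) -> (forall x, 0 <= x <= b -> 0 <= g x) ->
  0 <= p < q -> q <= b -> (forall x, p < x < q -> 0 < g x) ->
  0 < RInt g 0 b.
Proof.
intros Hg H0 Hp Hq H.
rewrite (RInt_split g 0 p b), (RInt_split g p q b) by trivial.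
assert (0 <= RInt g 0 p).
{ apply RInt_ge_0; [lra | apply ex_RInt_cont; trivial | intros; apply H0; lra]. }
assert (0 <= RInt g q b).
{ apply RInt_ge_0; [lra | apply ex_RInt_cont; trivial | intros; apply H0; lra]. }
assert (0 < RInt g p q) by (apply RInt_gt_0; [lra | trivial | intros; apply Hg]).
lra.
Qed.

(** The solution of w'' = g, w(0) = w'(0) = 0. Thus u = c - [dint g] is the integral form of u'' =
    -g, u(0) = c, u'(0) = 0. *)
Definition dint (g : R -> R) (t : R) : R := RInt (fun s => RInt g 0 s) 0 t.

Lemma dint_derive (g : R -> R) (t : R) :
  (forall x, continuous g x) -> is_derive (dint g) t (RInt g 0 t).
Proof.
intros Hg; apply (RInt_cont_derive (fun s => RInt g 0 s)).
apply RInt_cont_continuous, Hg.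
Qed.

Lemma dint_continuous (g : R -> R) :
  (forall x, continuous g x) -> forall t, continuous (dint g) t.
Proof.
intros Hg; apply (RInt_cont_continuous (fun s => RInt g 0 s)).
apply RInt_cont_continuous, Hg.
Qed.

Lemma dint_0 (g : R -> R) : dint g 0 = 0.
Proof. apply (RInt_point 0 (fun s => RInt g 0 s)). Qed.

Lemma dint_ext (g1 g2 : R -> R) (t : R) :
  0 <= t -> (forall x, 0 <= x <= t -> g1 x = g2 x) -> dint g1 t = dint g2 t.
Proof.
intros Ht H; apply RInt_ext.
rewrite Rmin_left, Rmax_right by lra; intros s Hs.
apply RInt_ext.
rewrite Rmin_left, Rmax_right by lra; intros x Hx; apply H; lra.
Qed.

Lemma dint_scal (g : R -> R) (k t : R) :
  (forall x, continuous g x) -> dint (fun x => k * g x) t = k * dint g t.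
Proof.
intros Hg; unfold dint.
transitivity (RInt (fun s => scal k (RInt g 0 s)) 0 t).
- apply RInt_ext; intros s _.
  apply (RInt_scal g 0 s k), ex_RInt_cont, Hg.
- apply (RInt_scal (fun s => RInt g 0 s) 0 t k).
  apply ex_RInt_cont, RInt_cont_continuous, Hg.
Qed.

Lemma dint_le (g1 g2 : R -> R) (t : R) :
  (forall x, continuous g1 x) -> (forall x, continuous g2 x) -> 0 <= t ->
  (forall x, 0 <= x <= t -> g1 x <= g2 x) -> dint g1 t <= dint g2 t.
Proof.
intros H1 H2 Ht H; apply RInt_le; trivial.
1,2: apply ex_RInt_cont, RInt_cont_continuous; trivial.
intros s Hs; apply RInt_le; try lra.
1,2: apply ex_RInt_cont; trivial.
intros x Hx; apply H; lra.
Qed.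

Lemma dint_dist (g1 g2 : R -> R) (T t eps : R) :
  (forall x, continuous g1 x) -> (forall x, continuous g2 x) -> 0 <= t <= T ->
  0 <= eps ->
  (forall x, 0 <= x <= T -> Rabs (g1 x - g2 x) <= eps) ->
  Rabs (dint g1 t - dint g2 t) <= T * (T * eps).
Proof.
intros H1 H2 Ht He H.
apply Rle_trans with ((t - 0) * (T * eps)).
- apply RInt_dist; try (apply RInt_cont_continuous; trivial); try lra.
  intros s Hs; apply Rle_trans with ((s - 0) * eps).
  + apply RInt_dist; trivial; [lra|]; intros x Hx; apply H; lra.
  + apply Rmult_le_compat_r; lra.
- apply Rmult_le_compat_r; [apply Rmult_le_pos; lra | lra].
Qed.

Lemma dint_mono (g : R -> R) (s t : R) :
  (forall x, continuous g x) -> (forall x, 0 <= x <= t -> 0 <= g x) ->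
  0 <= s <= t -> dint g s <= dint g t.
Proof.
intros Hg H0 Hs; unfold dint.
rewrite (RInt_split _ 0 s t) by (apply RInt_cont_continuous, Hg).
assert (0 <= RInt (fun s => RInt g 0 s) s t); [|lra].
apply RInt_ge_0; [lra | apply ex_RInt_cont, RInt_cont_continuous, Hg|].
intros x Hx; apply RInt_ge_0; [lra | apply ex_RInt_cont, Hg|].
intros y Hy; apply H0; lra.
Qed.

Lemma RInt_mono (g : R -> R) (s t : R) :
  (forall x, continuous g x) -> (forall x, 0 <= x <= t -> 0 <= g x) ->
  0 <= s <= t -> RInt g 0 s <= RInt g 0 t.
Proof.
intros Hg H0 Hs; rewrite (RInt_split g 0 s t) by trivial.
assert (0 <= RInt g s t); [|lra].
apply RInt_ge_0; [lra | apply ex_RInt_cont, Hg|].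
intros y Hy; apply H0; lra.
Qed.

(** For g >= 0 the inner integral is nondecreasing, so [dint g] is convex and vanishes at 0; this is
    the chord inequality, free of division. *)
Lemma dint_convex (g : R -> R) (s t : R) :
  (forall x, continuous g x) -> (forall x, 0 <= x <= t -> 0 <= g x) ->
  0 <= s <= t -> t * dint g s <= s * dint g t.
Proof.
intros Hg H0 Hs.
assert (Hw := RInt_cont_continuous g 0 Hg).
assert (H1 : dint g s <= RInt g 0 s * (s - 0)).
{ apply (RInt_bounds (fun s => RInt g 0 s) 0 s 0); trivial; [lra|].
  intros x Hx; split; [|apply RInt_mono; trivial; [|lra]].
  - apply RInt_ge_0; [lra | apply ex_RInt_cont, Hg | intros; apply H0; lra].
  - intros; apply H0; lra. }
assert (H2 : RInt g 0 s * (t - s) <= RInt (fun s => RInt g 0 s) s t).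
{ apply (RInt_bounds (fun s => RInt g 0 s) s t _ (RInt g 0 t)); trivial; [lra|].
  intros x Hx; split; apply RInt_mono; trivial; try lra; intros; apply H0; lra. }
assert (H3 : dint g t = dint g s + RInt (fun s => RInt g 0 s) s t).
{ apply RInt_split, Hw. }
(* With w the inner integral, (t - s) * [dint g s] and s * (integral of w over [s, t]) are separated
   by s * (t - s) * w(s). *)
rewrite H3; nra.
Qed.

Lemma dint_lip (g : R -> R) (T k s t : R) :
  (forall x, continuous g x) -> (forall x, 0 <= x <= T -> 0 <= g x <= k) ->
  0 <= s <= T -> 0 <= t <= T ->
  Rabs (dint g t - dint g s) <= k * T * Rabs (t - s).
Proof.
intros Hg Hk.
assert (Hw := RInt_cont_continuous g 0 Hg).
assert (Hle : forall s t, 0 <= s <= T -> 0 <= t <= T -> s <= t ->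
  Rabs (dint g t - dint g s) <= k * T * Rabs (t - s)).
{ clear s t; intros s t Hs Ht Hst.
  assert (H3 : dint g t = dint g s + RInt (fun s => RInt g 0 s) s t).
  { apply RInt_split, Hw. }
  assert (0 <= k) by (apply Rle_trans with (g s); apply Hk; lra).
  destruct (RInt_bounds (fun s => RInt g 0 s) s t 0 (k * T) Hw Hst) as [H1 H2].
  { intros x Hx.
    destruct (RInt_bounds g 0 x 0 k Hg) as [H1 H2]; [lra | intros; apply Hk; lra|].
    split; [lra|]; apply Rle_trans with (1 := H2), Rmult_le_compat_l; lra. }
  rewrite H3, !Rabs_pos_eq; lra. }
intros Hs Ht; destruct (Rle_dec s t); [apply Hle; trivial|].
rewrite Rabs_minus_sym, (Rabs_minus_sym t s); apply Hle; trivial; lra.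
Qed.

(** * Compactness of equi-Lipschitz families *)

(** Subsequences are represented by infinite sets of indices, so that extraction becomes passing to
    a subset. *)
Definition infinite (S : nat -> Prop) : Prop := forall n, exists m, (n <= m)%nat /\ S m.

Lemma infinite_split (S P : nat -> Prop) :
  infinite S -> infinite (fun n => S n /\ P n) \/ infinite (fun n => S n /\ ~ P n).
Proof.
intros HS; destruct (classic (infinite (fun n => S n /\ P n))) as [H|H]; [left; exact H|].
right; intros n.
apply not_all_ex_not in H; destruct H as [n0 H0].
destruct (HS (Nat.max n n0)) as [m [Hm Sm]].
exists m; split; [lia|]; split; [exact Sm|].
intros Pm; apply H0; exists m; split; [lia | tauto].
Qed.

(** Induction on the number [k] of cells of length [eps]: either infinitely many values lie in the
    lowest cell, or it can be discarded. *)
Lemma pigeonhole_point (x : nat -> R) (eps : R) (k : nat) :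
  0 < eps -> forall (S : nat -> Prop) (lo : R), infinite S ->
  (forall n, S n -> lo <= x n <= lo + INR k * eps) ->
  exists S' : nat -> Prop, infinite S' /\ (forall n, S' n -> S n) /\
    forall n m, S' n -> S' m -> Rabs (x n - x m) <= eps.
Proof.
intros He; induction k as [|k IH]; intros S lo HS Hx.
- exists S; split; [exact HS|]; split; [tauto|].
  intros n m Sn Sm; assert (Hn := Hx n Sn); assert (Hm := Hx m Sm); simpl in Hn, Hm.
  apply Rabs_le; lra.
- destruct (infinite_split S (fun n => x n <= lo + eps) HS) as [H|H].
  + exists (fun n => S n /\ x n <= lo + eps); split; [exact H|]; split; [tauto|].
    intros n m [Sn Hn] [Sm Hm]; apply Hx in Sn; apply Hx in Sm; apply Rabs_le; lra.
  + destruct (IH _ (lo + eps) H) as [S' [H1 [H2 H3]]].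
    * intros n [Sn Hn]; apply Hx in Sn; rewrite S_INR in Sn; lra.
    * exists S'; split; [exact H1|]; split; [|exact H3].
      intros n Hn; apply (H2 n Hn).
Qed.

Lemma pigeonhole_grid (u : nat -> R -> R) (M eps : R) (tau : nat -> R) (N : nat) :
  0 < eps -> (forall n t, 0 <= u n t <= M) ->
  forall S : nat -> Prop, infinite S ->
  exists S' : nat -> Prop, infinite S' /\ (forall n, S' n -> S n) /\
    forall i n m, (i < N)%nat -> S' n -> S' m -> Rabs (u n (tau i) - u m (tau i)) <= eps.
Proof.
intros He Hu; induction N as [|N IH]; intros S HS.
- exists S; split; [exact HS|]; split; [tauto | intros; lia].
- destruct (IH S HS) as [S1 [H1 [H2 H3]]].
  (* The cells of length [eps] needed to cover [0, M] number at most k + 1; the maximum with 0 gives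
     [nfloor_ex] a nonnegative argument. *)
  destruct (nfloor_ex (Rmax 0 (M / eps)) (Rmax_l _ _)) as [k [_ Hk]].
  destruct (pigeonhole_point (fun n => u n (tau N)) eps (k + 1) He S1 0 H1)
    as [S' [H4 [H5 H6]]].
  + intros n _; split; [apply Hu|].
    apply Rle_trans with (1 := proj2 (Hu n (tau N))).
    rewrite plus_INR; simpl INR.
    assert (H := Rmax_r 0 (M / eps)).
    replace M with (M / eps * eps) by (field; lra).
    rewrite Rplus_0_l; apply Rmult_le_compat_r; lra.
  + exists S'; split; [exact H4|]; split; [auto|].
    intros i n m Hi Sn Sm.
    destruct (Nat.eq_dec i N) as [->|Hne]; [auto|].
    apply H3; [lia | auto | auto].
Qed.

(** An eps/3 argument: agreement up to eps/3 on a finite grid, and oscillation at most eps/3 between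
    t and the grid point below it. *)
Lemma equilipschitz_totally_bounded (u : nat -> R -> R) (M L T eps : R) :
  0 < eps -> 0 <= L -> (forall n t, 0 <= u n t <= M) ->
  (forall n s t, Rabs (u n s - u n t) <= L * Rabs (s - t)) ->
  forall S : nat -> Prop, infinite S ->
  exists S' : nat -> Prop, infinite S' /\ (forall n, S' n -> S n) /\
    forall n m t, S' n -> S' m -> 0 <= t <= T -> Rabs (u n t - u m t) <= eps.
Proof.
intros He HL Hu Hlip S HS.
(* L + 1 instead of L keeps the mesh finite when L = 0. *)
set (d := eps / (3 * (L + 1))).
assert (Hd : 0 < d) by (apply Rdiv_lt_0_compat; lra).
assert (HLd : L * d <= eps / 3).
{ replace (eps / 3) with ((L + 1) * d) by (unfold d; field; lra).
  apply Rmult_le_compat_r; lra. }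
destruct (nfloor_ex (Rmax 0 (T / d)) (Rmax_l _ _)) as [N [_ HN]].
assert (HN' := Rmax_r 0 (T / d)).
destruct (pigeonhole_grid u M (eps / 3) (fun i => INR i * d) (N + 1)) with S
  as [S' [H1 [H2 H3]]]; trivial; [lra|].
exists S'; split; [exact H1|]; split; [exact H2|].
intros n m t Sn Sm Ht.
destruct (nfloor_ex (t / d)) as [i Hi].
{ apply Rdiv_le_0_compat; lra. }
assert (Htd : t = t / d * d) by (field; lra).
assert (HTd : t / d <= T / d).
{ apply Rmult_le_compat_r; [left; apply Rinv_0_lt_compat; lra | lra]. }
assert (Hclose : forall n, Rabs (u n t - u n (INR i * d)) <= eps / 3).
{ intros k; apply Rle_trans with (2 := HLd), Rle_trans with (1 := Hlip k _ _).
  apply Rmult_le_compat_l; [lra|]; apply Rabs_le; rewrite Htd; nra. }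
assert (Hin : (i < N + 1)%nat).
{ apply INR_lt; rewrite plus_INR; simpl; lra. }
assert (Ha := Hclose n); assert (Hb := Hclose m); assert (Hc := H3 i n m Hin Sn Sm).
apply Rabs_le_between in Ha; apply Rabs_le_between in Hb; apply Rabs_le_between in Hc.
apply Rabs_le; lra.
Qed.

(** Diagonal extraction from nested infinite index sets [Q k], on which the functions agree up to an
    error tending to 0. The conclusion only records a uniform cluster point, which suffices for
    passing to the limit in closed relations. *)
Lemma arzela_ascoli (u : nat -> R -> R) (M L T : R) :
  0 <= L -> (forall n t, 0 <= u n t <= M) ->
  (forall n s t, Rabs (u n s - u n t) <= L * Rabs (s - t)) ->
  exists v : R -> R, forall eps N, 0 < eps ->
    exists n, (N <= n)%nat /\ forall t, 0 <= t <= T -> Rabs (u n t - v t) <= eps.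
Proof.
intros HL Hu Hlip.
(* Each set is packed with its infinitude, so that one refinement step can be iterated by
   [nat_rect]. *)
assert (Hstep : forall (k : nat) (S : {S : nat -> Prop | infinite S}),
  {S' : {S : nat -> Prop | infinite S} | (forall n, proj1_sig S' n -> proj1_sig S n) /\
    forall n m t, proj1_sig S' n -> proj1_sig S' m -> 0 <= t <= T ->
      Rabs (u n t - u m t) <= / INR (k + 1)}).
{ intros k [S HS]; apply constructive_indefinite_description.
  destruct (equilipschitz_totally_bounded u M L T (/ INR (k + 1))) with S
    as [S' [H1 [H2 H3]]]; trivial.
  - apply Rinv_0_lt_compat, lt_0_INR; lia.
  - exists (exist _ S' H1); simpl; split; assumption. }
assert (Hall : infinite (fun _ => True)) by (intros n; exists n; auto).
set (Q := nat_rect (fun _ => {S : nat -> Prop | infinite S})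
  (exist _ _ Hall) (fun k S => proj1_sig (Hstep k S))).
assert (Hdec : forall j k n, (k <= j)%nat -> proj1_sig (Q j) n -> proj1_sig (Q k) n).
{ intros j k n H; induction H as [|j H IH]; [tauto|].
  intros Hn; apply IH, (proj1 (proj2_sig (Hstep j (Q j)))), Hn. }
assert (Hsmall : forall k n m t, proj1_sig (Q (S k)) n -> proj1_sig (Q (S k)) m ->
  0 <= t <= T -> Rabs (u n t - u m t) <= / INR (k + 1)).
{ intros k; exact (proj2 (proj2_sig (Hstep k (Q k)))). }
assert (Hphi : forall k, {m | (k <= m)%nat /\ proj1_sig (Q k) m}).
{ intros k; apply constructive_indefinite_description, (proj2_sig (Q k)). }
set (phi := fun k => proj1_sig (Hphi k)).
assert (Hphi1 : forall k, (k <= phi k)%nat) by (intros k; apply (proj2_sig (Hphi k))).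
assert (Hphi2 : forall k, proj1_sig (Q k) (phi k)) by (intros k; apply (proj2_sig (Hphi k))).
(* From rank [S K] on, the diagonal stays inside [Q (S K)], so it is uniformly Cauchy on [0, T]. *)
assert (Hcau : forall K j k t, (S K <= j)%nat -> (S K <= k)%nat -> 0 <= t <= T ->
  Rabs (u (phi j) t - u (phi k) t) <= / INR (K + 1)).
{ intros K j k t Hj Hk Ht; apply Hsmall; trivial.
  - apply (Hdec j); trivial.
  - apply (Hdec k); trivial. }
assert (HK : forall eps, 0 < eps -> exists K, / INR (K + 1) < eps).
{ intros eps He; destruct (archimed_cor1 eps He) as [K [H1 H2]].
  exists K; apply Rle_lt_trans with (2 := H1), Rinv_le_contravar.
  - apply lt_0_INR; lia.
  - apply le_INR; lia. }
exists (fun t => real (Lim_seq (fun k => u (phi k) t))).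
intros eps N He; destruct (HK eps He) as [K HKe].
exists (phi (N + S K)%nat); split; [apply Nat.le_trans with (2 := Hphi1 _); lia|].
intros t Ht.
assert (Hlim : is_lim_seq (fun k => u (phi k) t) (Lim_seq (fun k => u (phi k) t))).
{ assert (Hc : ex_lim_seq_cauchy (fun k => u (phi k) t)).
  { intros e; destruct (HK e (cond_pos e)) as [K' HK'].
    exists (S K'); intros n m Hn Hm; apply Rle_lt_trans with (2 := HK').
    apply Hcau; trivial. }
  apply ex_lim_seq_cauchy_corr in Hc; destruct Hc as [l Hl].
  rewrite (is_lim_seq_unique _ _ Hl); exact Hl. }
set (l := Lim_seq (fun k => u (phi k) t)) in *.
set (x := u (phi (N + S K)%nat) t).
assert (Hb : forall k, (S K <= k)%nat -> x - eps <= u (phi k) t <= x + eps).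
{ intros k Hk; assert (H := Hcau K (N + S K)%nat k t ltac:(lia) Hk Ht).
  apply Rabs_le_between in H; unfold x; lra. }
assert (H1 : Rbar_le (x - eps) l).
{ apply (is_lim_seq_le_loc (fun _ => x - eps) (fun k => u (phi k) t)); trivial.
  - exists (S K); intros k Hk; apply Hb, Hk.
  - apply is_lim_seq_const. }
assert (H2 : Rbar_le l (x + eps)).
{ apply (is_lim_seq_le_loc (fun k => u (phi k) t) (fun _ => x + eps)); trivial.
  - exists (S K); intros k Hk; apply Hb, Hk.
  - apply is_lim_seq_const. }
(* The two bounds exclude infinite limits, so [real] does not fall back on its default value. *)
destruct l as [l| |]; simpl in *; try contradiction.
apply Rabs_le; lra.
Qed.

(** * The delayed equation and shooting *)

(** Before time [h] the delayed argument is frozen at 0, so the history is the constant v(0). For h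
    = 0 and r >= 0 this is the right-hand side without delay. *)
Definition delayed_rhs (A F : R -> R) (h : R) (v : R -> R) (r : R) : R :=
  A r * F (v (Rmax 0 (r - h))).

Lemma delayed_rhs_continuous (A F : R -> R) (h : R) (v : R -> R) :
  (forall x, continuous A x) -> (forall x, continuous F x) ->
  (forall x, continuous v x) -> forall r, continuous (delayed_rhs A F h v) r.
Proof.
intros HA HF Hv r.
apply (continuous_mult A (fun r => F (v (Rmax 0 (r - h))))); [apply HA|].
apply (continuous_comp (fun r => v (Rmax 0 (r - h))) F); [|apply HF].
apply (continuous_comp (fun r => Rmax 0 (r - h)) v); [|apply Hv].
apply lipschitz_continuous with 1; [lra|].
intros s t; unfold Rmax; repeat destruct Rle_dec; unfold Rabs;
  repeat destruct Rcase_abs; lra.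
Qed.

Lemma delayed_rhs_bounds (A F : R -> R) (h K B : R) (v : R -> R) (r : R) :
  (forall x, 0 <= A x <= K) -> (forall x, 0 <= F x <= B) ->
  0 <= delayed_rhs A F h v r <= K * B.
Proof.
intros HA HF; unfold delayed_rhs.
assert (H1 := HA r); assert (H2 := HF (v (Rmax 0 (r - h)))); nra.
Qed.

Lemma delay_range (T h r : R) : 0 <= h -> 0 <= r <= T -> 0 <= Rmax 0 (r - h) <= T.
Proof. intros Hh Hr; unfold Rmax; destruct Rle_dec; lra. Qed.

Fixpoint delay_iter (A F : R -> R) (h c : R) (k : nat) (t : R) : R :=
  match k with
  | O => c
  | S k => c - dint (delayed_rhs A F h (delay_iter A F h c k)) t
  end.

Lemma delay_iter_continuous (A F : R -> R) (h c : R) (k : nat) :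
  (forall x, continuous A x) -> (forall x, continuous F x) ->
  forall t, continuous (delay_iter A F h c k) t.
Proof.
intros HA HF; induction k as [|k IH]; intros t.
- apply continuous_const.
- apply (continuous_minus (fun _ => c) (dint (delayed_rhs A F h (delay_iter A F h c k)))).
  + apply continuous_const.
  + apply dint_continuous, delayed_rhs_continuous; trivial.
Qed.

(* Each iteration extends the interval of validity by the length h of the delay. *)
Lemma delay_iter_stable (A F : R -> R) (h c : R) (k : nat) :
  0 < h -> forall t, 0 <= t <= INR k * h ->
  delay_iter A F h c (S k) t = delay_iter A F h c k t.
Proof.
intros Hh; induction k as [|k IH]; intros t Ht.
- simpl in Ht; replace t with 0 by lra; simpl; rewrite dint_0; ring.
- rewrite S_INR in Ht.
  change (c - dint (delayed_rhs A F h (delay_iter A F h c (S k))) t =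
    c - dint (delayed_rhs A F h (delay_iter A F h c k)) t).
  f_equal; apply dint_ext; [lra|].
  intros x Hx; unfold delayed_rhs; rewrite IH; trivial.
  assert (0 <= INR k * h) by (apply Rmult_le_pos; [apply pos_INR | lra]).
  unfold Rmax; destruct Rle_dec; lra.
Qed.

(** For a fixed number of iterations, closeness of the initial heights propagates through each
    integration by uniform continuity of [F]. *)
Lemma delay_iter_param (A F : R -> R) (T K h : R) (k : nat) :
  0 <= T -> 0 <= h ->
  (forall x, continuous A x) -> (forall x, continuous F x) ->
  (forall x, 0 <= A x <= K) ->
  (forall eps, 0 < eps -> exists d, 0 < d /\
    forall x y, Rabs (x - y) < d -> Rabs (F x - F y) < eps) ->
  forall eps, 0 < eps -> exists d, 0 < d /\ forall c c', Rabs (c - c') < d ->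
    forall t, 0 <= t <= T ->
      Rabs (delay_iter A F h c k t - delay_iter A F h c' k t) < eps.
Proof.
intros HT Hh HA HF HK HFu; induction k as [|k IH]; intros eps He.
- exists eps; split; [exact He|]; intros c c' Hc t Ht; exact Hc.
- assert (0 <= K) by (apply Rle_trans with (A 0); apply HK).
  (* Double integration against [A] multiplies errors by at most D - 1, so a tolerance eps / (2 * D)
     on [F] costs less than eps / 2; the other half is for |c - c'|. *)
  set (D := T * (T * K) + 1).
  assert (HD : 1 <= D).
  { assert (0 <= T * (T * K)) by (repeat apply Rmult_le_pos; lra); unfold D; lra. }
  assert (HeD : 0 < eps / (2 * D)) by (apply Rdiv_lt_0_compat; lra).
  destruct (HFu _ HeD) as [d1 [Hd1 HF1]].
  destruct (IH d1 Hd1) as [d2 [Hd2 HI]].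
  exists (Rmin d2 (eps / 2)); split; [apply Rmin_glb_lt; lra|].
  intros c c' Hc t Ht; simpl.
  assert (Hc1 := Rlt_le_trans _ _ _ Hc (Rmin_l _ _)).
  assert (Hc2 := Rlt_le_trans _ _ _ Hc (Rmin_r _ _)).
  assert (Hg : Rabs (dint (delayed_rhs A F h (delay_iter A F h c k)) t -
    dint (delayed_rhs A F h (delay_iter A F h c' k)) t) <= T * (T * (K * (eps / (2 * D))))).
  { apply dint_dist; trivial.
    1,2: apply delayed_rhs_continuous; trivial; apply delay_iter_continuous; trivial.
    - apply Rmult_le_pos; lra.
    - intros x Hx; unfold delayed_rhs.
      rewrite <- Rmult_minus_distr_l, Rabs_mult, (Rabs_pos_eq (A x)) by apply HK.
      apply Rmult_le_compat; [apply HK | apply Rabs_pos | apply HK|].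
      left; apply HF1, HI; trivial; apply delay_range; trivial. }
  assert (Hs : T * (T * (K * (eps / (2 * D)))) = (D - 1) * (eps / (2 * D))).
  { unfold D; ring. }
  assert (Hs2 : D * (eps / (2 * D)) = eps / 2) by (field; lra).
  apply Rabs_le_between in Hg; apply Rabs_lt_between in Hc2.
  apply Rabs_lt_between; lra.
Qed.

(** Once (N + 1) * h >= T, the iterate of rank N + 1 is a fixed point on [0, T]. This rank is the
    same for all [c], so continuity in [c] is inherited from the iterates. *)
Lemma delay_solution (A F : R -> R) (T K h : R) :
  0 <= T -> 0 < h ->
  (forall x, continuous A x) -> (forall x, continuous F x) ->
  (forall x, 0 <= A x <= K) ->
  (forall eps, 0 < eps -> exists d, 0 < d /\
    forall x y, Rabs (x - y) < d -> Rabs (F x - F y) < eps) ->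
  exists U : R -> R -> R,
    (forall c t, continuous (U c) t) /\
    (forall c t, 0 <= t <= T -> U c t = c - dint (delayed_rhs A F h (U c)) t) /\
    (forall eps, 0 < eps -> exists d, 0 < d /\ forall c c', Rabs (c - c') < d ->
      forall t, 0 <= t <= T -> Rabs (U c t - U c' t) < eps).
Proof.
intros HT Hh HA HF HK HFu.
destruct (nfloor_ex (T / h)) as [N [_ HN]]; [apply Rdiv_le_0_compat; lra|].
exists (fun c => delay_iter A F h c (N + 1)); split; [|split].
- intros; apply delay_iter_continuous; trivial.
- intros c t Ht; symmetry; apply (delay_iter_stable A F h c (N + 1)); trivial.
  split; [lra|].
  rewrite plus_INR; simpl INR.
  replace T with (T / h * h) in Ht by (field; lra).
  apply Rle_trans with (1 := proj2 Ht), Rmult_le_compat_r; lra.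
- apply delay_iter_param with K; trivial; lra.
Qed.

(** * Estimates for the nonlocal boundary condition *)

Section BoundaryFunctional.

Variables (T eta alpha c : R) (g U : R -> R).
Hypothesis heta : 0 < eta < T.
Hypothesis halpha : 0 < alpha < / eta.
Hypothesis hg : forall x, continuous g x.
Hypothesis hg0 : forall x, 0 <= x <= T -> 0 <= g x.
Hypothesis hU : forall x, continuous U x.
Hypothesis hUg : forall t, 0 <= t <= T -> U t = c - dint g t.

Lemma alpha_eta_bounds : 0 < alpha * eta < 1.
Proof using heta halpha.
split; [apply Rmult_lt_0_compat; lra|].
replace 1 with (/ eta * eta) by (field; lra).
apply Rmult_lt_compat_r; lra.
Qed.

Lemma dint_solution_decreasing (s t : R) : 0 <= s <= t -> t <= T -> U t <= U s <= c.
Proof using hg hg0 hUg.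
intros Hs Ht; rewrite !hUg by lra.
assert (H1 : dint g s <= dint g t) by (apply dint_mono; trivial; intros; apply hg0; lra).
assert (H2 : dint g 0 <= dint g s).
{ apply dint_mono; trivial; [intros; apply hg0; lra | lra]. }
rewrite dint_0 in H2; lra.
Qed.

(** As U decreases, alpha * int_0^eta U >= alpha * eta * U(T), which exceeds U(T) since U(T) < 0 and
    alpha * eta < 1. *)
Lemma boundary_value_lt_integral :
  U T < 0 -> U T < alpha * RInt U 0 eta.
Proof using heta halpha hg hg0 hU hUg.
intros HT; assert (Hae := alpha_eta_bounds).
destruct (RInt_bounds U 0 eta (U T) c hU) as [H _]; [lra| |].
- intros x Hx; apply dint_solution_decreasing; lra.
- apply Rmult_le_compat_l with (r := alpha) in H; [nra | lra].
Qed.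

Lemma integral_lt_boundary_value :
  alpha * eta * c < U T -> alpha * RInt U 0 eta < U T.
Proof using heta halpha hg hg0 hU hUg.
intros HT.
destruct (RInt_bounds U 0 eta (U T) c hU) as [_ H]; [lra| |].
- intros x Hx; apply dint_solution_decreasing; lra.
- apply Rmult_le_compat_l with (r := alpha) in H; [nra | lra].
Qed.

(* Concavity: [U eta] lies above the chord from [(0, c)] to [(T, U T)]. *)
Lemma boundary_value_lower_bound :
  alpha * RInt U 0 eta <= U T -> 0 <= U T /\ alpha * eta * (1 - eta / T) * c <= U T.
Proof using heta halpha hg hg0 hU hUg.
intros HPhi; assert (Hae := alpha_eta_bounds).
assert (HT : 0 <= U T).
{ destruct (Rle_dec 0 (U T)) as [H|H]; [exact H|].
  assert (H1 := boundary_value_lt_integral (Rnot_le_lt _ _ H)); lra. }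
split; [exact HT|].
destruct (RInt_bounds U 0 eta (U eta) c hU) as [H _]; [lra| |].
{ intros x Hx; apply dint_solution_decreasing; lra. }
assert (Hc := dint_convex g eta T hg hg0 ltac:(lra)).
assert (H1 := hUg eta ltac:(lra)); assert (H2 := hUg T ltac:(lra)).
(* Convexity gives T * U(eta) >= (T - eta) * c + eta * U(T), and the last term is nonnegative. *)
assert (H3 : (1 - eta / T) * c <= U eta).
{ apply Rmult_le_reg_l with T; [lra|].
  replace (T * ((1 - eta / T) * c)) with ((T - eta) * c) by (field; lra).
  nra. }
apply Rmult_le_compat_l with (r := alpha) in H; [|lra].
apply Rmult_le_compat_l with (r := alpha * eta) in H3; [|lra].
lra.
Qed.

End BoundaryFunctional.

(** The height bound [b], the Lipschitz constant K * B * T and the lower bound [Rmin c1 c2] do not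
    involve [h]: they give compactness as h -> 0 and keep the limit away from zero. *)
Lemma shooting (A F : R -> R) (T eta alpha K B h b c1 c2 e m : R) :
  0 < eta < T -> 0 < alpha < / eta -> 0 < h ->
  (forall x, continuous A x) -> (forall x, continuous F x) ->
  (forall x, 0 <= A x <= K) -> (forall x, 0 <= F x <= B) ->
  (forall eps, 0 < eps -> exists d, 0 < d /\
    forall x y, Rabs (x - y) < d -> Rabs (F x - F y) < eps) ->
  0 < c1 <= b -> 0 < c2 <= b ->
  (forall x, x <= c1 -> F x <= e * c1) -> e * dint A T < 1 - alpha * eta ->
  (forall x, alpha * eta * (1 - eta / T) * c2 <= x <= c2 -> m * c2 <= F x) ->
  1 < m * dint A T ->
  exists u : R -> R,
    (forall t, 0 <= u t <= b) /\
    (forall s t, Rabs (u s - u t) <= K * B * T * Rabs (s - t)) /\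
    Rmin c1 c2 <= u 0 /\
    (forall t, 0 <= t <= T -> u t = u 0 - dint (delayed_rhs A F h u) t) /\
    u T = alpha * RInt u 0 eta.
Proof.
intros Heta Halpha Hh HA HF HK HB HFu Hc1 Hc2 Hsmall He Hlarge Hm.
assert (Hae := alpha_eta_bounds T eta alpha Heta Halpha).
destruct (delay_solution A F T K h) as [U [HUc [HU HUp]]]; trivial; [lra|].
assert (Hgc : forall c x, continuous (delayed_rhs A F h (U c)) x).
{ intros c; apply delayed_rhs_continuous; trivial. }
assert (Hg0 : forall c x, 0 <= delayed_rhs A F h (U c) x <= K * B).
{ intros c x; apply delayed_rhs_bounds; trivial. }
assert (Hg0' : forall c x, 0 <= x <= T -> 0 <= delayed_rhs A F h (U c) x).
{ intros c x _; apply Hg0. }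
set (Phi := fun c => U c T - alpha * RInt (U c) 0 eta).
assert (HPhic : continuity Phi).
{ intros c0; apply continuity_pt_filterlim; apply continuous_eps.
  intros eps Heps.
  destruct (HUp (eps / 2)) as [d [Hd HUd]]; [lra|].
  exists d; split; [exact Hd|]; intros c Hc.
  assert (H1 := HUd c c0 Hc T ltac:(lra)).
  assert (H2 : Rabs (RInt (U c) 0 eta - RInt (U c0) 0 eta) <= (eta - 0) * (eps / 2)).
  { apply RInt_dist; trivial; [lra|]; intros x Hx; left; apply HUd; trivial; lra. }
  apply Rabs_lt_between in H1; apply Rabs_le_between in H2.
  apply Rabs_lt_between; unfold Phi; nra. }
assert (HPhi1 : 0 < Phi c1).
{ assert (H : alpha * RInt (U c1) 0 eta < U c1 T); [|unfold Phi; lra].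
  apply (integral_lt_boundary_value T eta alpha c1 (delayed_rhs A F h (U c1))); auto.
  (* The solution stays below [c1] but may become negative, hence [Hsmall] for all x <= c1. Then
     U(T) >= c1 * (1 - e * [dint A T]) > alpha * eta * c1. *)
  assert (H1 : dint (delayed_rhs A F h (U c1)) T <= e * c1 * dint A T).
  { rewrite <- dint_scal by trivial; apply dint_le; auto; [|lra|].
    - intros x; apply (continuous_scal_r (e * c1) A), HA.
    - intros x Hx; unfold delayed_rhs; rewrite Rmult_comm.
      apply Rmult_le_compat_r; [apply HK|]; apply Hsmall.
      assert (Hr := delay_range T h x ltac:(lra) Hx).
      apply (dint_solution_decreasing T c1 (delayed_rhs A F h (U c1)) (U c1)
        (Hgc c1) (Hg0' c1) (HU c1) _ T); lra. }
  rewrite (HU c1 T) by lra; nra. }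
assert (HPhi2 : Phi c2 < 0).
{ apply Rnot_le_lt; intros Hge.
  assert (H : alpha * RInt (U c2) 0 eta <= U c2 T) by (unfold Phi in Hge; lra).
  apply (boundary_value_lower_bound T eta alpha c2 (delayed_rhs A F h (U c2))) in H;
    auto.
  destruct H as [H0 H].
  (* If Phi(c2) >= 0, the solution stays in the band of [Hlarge], so U(T) <= c2 * (1 - m *
     [dint A T]) < 0, against [H0]. *)
  assert (H1 : m * c2 * dint A T <= dint (delayed_rhs A F h (U c2)) T).
  { rewrite <- dint_scal by trivial; apply dint_le; auto; [|lra|].
    - intros x; apply (continuous_scal_r (m * c2) A), HA.
    - intros x Hx; unfold delayed_rhs; rewrite (Rmult_comm (A x)).
      apply Rmult_le_compat_r; [apply HK|]; apply Hlarge.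
      assert (Hr := delay_range T h x ltac:(lra) Hx).
      assert (Hd := dint_solution_decreasing T c2 (delayed_rhs A F h (U c2)) (U c2)
        (Hgc c2) (Hg0' c2) (HU c2) (Rmax 0 (x - h)) T Hr (Rle_refl T)); lra. }
  rewrite (HU c2 T) in H0 by lra; nra. }
(* The order of [c1] and [c2] is unknown, so [c] lies between their minimum and maximum. *)
destruct (IVT_gen Phi c1 c2 0 HPhic) as [c [Hc HPhi]].
{ rewrite Rmin_right, Rmax_left by lra; lra. }
assert (HUT : U c T = alpha * RInt (U c) 0 eta) by (unfold Phi in HPhi; lra).
assert (HUT0 : 0 <= U c T).
{ apply (boundary_value_lower_bound T eta alpha c (delayed_rhs A F h (U c))); auto; lra. }
assert (HcM : c <= b).
{ apply Rle_trans with (1 := proj2 Hc), Rmax_lub; lra. }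
assert (Hu0 : U c 0 = c) by (rewrite HU, dint_0 by lra; ring).
assert (Hcl : forall t, 0 <= clamp T t <= T) by (intros; apply clamp_range; lra).
(* Freezing the solution outside [0, T] makes its bounds and Lipschitz estimate hold on all of R. *)
exists (fun t => U c (clamp T t)); split; [|split; [|split; [|split]]].
- intros t.
  assert (Hd := dint_solution_decreasing T c (delayed_rhs A F h (U c)) (U c)
    (Hgc c) (Hg0' c) (HU c) (clamp T t) T (Hcl t) (Rle_refl T)); lra.
- intros s t; rewrite !HU by trivial.
  replace (c - _ - _) with (dint (delayed_rhs A F h (U c)) (clamp T t) -
    dint (delayed_rhs A F h (U c)) (clamp T s)) by ring.
  apply Rle_trans with (K * B * T * Rabs (clamp T t - clamp T s)).
  + apply dint_lip; trivial; intros; apply Hg0.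
  + apply Rmult_le_compat_l.
    * apply Rmult_le_pos; [apply Rle_trans with (1 := proj1 (Hg0 c 0)), Hg0 | lra].
    * rewrite (Rabs_minus_sym s t); apply clamp_lip.
- rewrite clamp_id, Hu0 by lra; apply Hc.
- intros t Ht; rewrite !clamp_id, HU, Hu0 by lra.
  f_equal; apply dint_ext; [lra|]; intros x Hx; unfold delayed_rhs.
  rewrite clamp_id; trivial; apply delay_range; lra.
- rewrite clamp_id, HUT by lra; f_equal; apply RInt_ext.
  rewrite Rmin_left, Rmax_right by lra; intros x Hx; rewrite clamp_id; trivial; lra.
Qed.

(** * Vanishing delay *)

Lemma Req_of_small_dist (x y C : R) :
  (forall eps, 0 < eps -> Rabs (x - y) <= C * eps) -> x = y.
Proof.
intros H; apply Rminus_diag_uniq; destruct (Req_dec (x - y) 0) as [H0|H0]; [exact H0|].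
apply Rabs_pos_lt in H0.
assert (HC : 0 < Rabs C + 1) by (assert (H1 := Rabs_pos C); lra).
assert (He : 0 < Rabs (x - y) / (2 * (Rabs C + 1))) by (apply Rdiv_lt_0_compat; lra).
assert (H1 := H _ He); assert (H2 := Rle_abs C).
assert (H3 : (Rabs C + 1) * (Rabs (x - y) / (2 * (Rabs C + 1))) = Rabs (x - y) / 2)
  by (field; lra).
nra.
Qed.

(** Each relation passes to the cluster point because, for every eps, a single late [u n] makes it
    true up to a fixed multiple of eps. *)
Lemma undelayed_solution (A F : R -> R) (T eta alpha K L b m0 : R) (u : nat -> R -> R) :
  0 < eta < T -> 0 <= alpha -> 0 <= L ->
  (forall x, continuous A x) -> (forall x, continuous F x) ->
  (forall x, 0 <= A x <= K) ->
  (forall eps, 0 < eps -> exists d, 0 < d /\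
    forall x y, Rabs (x - y) < d -> Rabs (F x - F y) < eps) ->
  (forall n t, 0 <= u n t <= b) ->
  (forall n s t, Rabs (u n s - u n t) <= L * Rabs (s - t)) ->
  (forall n, m0 <= u n 0) ->
  (forall n t, 0 <= t <= T ->
    u n t = u n 0 - dint (delayed_rhs A F (/ INR (n + 1)) (u n)) t) ->
  (forall n, u n T = alpha * RInt (u n) 0 eta) ->
  exists v : R -> R,
    (forall t, continuous v t) /\
    (forall t, 0 <= t <= T -> 0 <= v t <= b) /\
    m0 <= v 0 /\
    (forall t, 0 <= t <= T -> v t = v 0 - dint (delayed_rhs A F 0 v) t) /\
    v T = alpha * RInt v 0 eta.
Proof.
intros Heta Halpha HL HA HF HK HFu Hb Hlip Hm0 Heq Hbc.
destruct (arzela_ascoli u b L T HL Hb Hlip) as [w Hw].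
set (v := fun t => w (clamp T t)).
assert (Hcl : forall t, 0 <= clamp T t <= T) by (intros; apply clamp_range; lra).
assert (Hv : forall eps N, 0 < eps ->
  exists n, (N <= n)%nat /\ forall t, 0 <= t <= T -> Rabs (u n t - v t) <= eps).
{ intros eps N He; destruct (Hw eps N He) as [n [Hn H]].
  exists n; split; [exact Hn|]; intros t Ht; unfold v; rewrite clamp_id; auto. }
assert (Hvlip : forall s t, Rabs (v s - v t) <= L * Rabs (s - t)).
{ intros s t; apply le_epsilon; intros eps He.
  destruct (Hw (eps / 2) O ltac:(lra)) as [n [_ H]].
  assert (H1 := H _ (Hcl s)); assert (H2 := H _ (Hcl t)).
  assert (H3 : Rabs (u n (clamp T s) - u n (clamp T t)) <= L * Rabs (s - t)).
  { apply Rle_trans with (1 := Hlip n _ _), Rmult_le_compat_l; [exact HL|].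
    apply clamp_lip. }
  apply Rabs_le_between in H1; apply Rabs_le_between in H2;
  apply Rabs_le_between in H3; unfold v; apply Rabs_le_between; lra. }
assert (Hvc : forall t, continuous v t).
{ intros t; apply lipschitz_continuous with L; trivial. }
assert (Huc : forall n t, continuous (u n) t).
{ intros n t; apply lipschitz_continuous with L; trivial. }
assert (HK0 : 0 <= K) by (apply Rle_trans with (A 0); apply HK).
exists v; split; [exact Hvc|]; split; [|split; [|split]].
- intros t Ht; split; apply le_epsilon; intros eps He;
  destruct (Hv eps O He) as [n [_ H]]; specialize (H t Ht);
  apply Rabs_le_between in H; specialize (Hb n t); lra.
- apply le_epsilon; intros eps He.
  destruct (Hv eps O He) as [n [_ H]]; specialize (H 0 ltac:(lra));
  apply Rabs_le_between in H; specialize (Hm0 n); lra.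
(* One eps for the value at t, one for the value at 0, and T * (T * K) * eps for the double
   integral. *)
- intros t Ht; apply Req_of_small_dist with (2 + T * (T * K)); intros eps He.
  destruct (HFu eps He) as [d [Hd HFd]].
  (* Removing the delay moves the argument of [F] by at most L * h <= d / 4, and replacing [u n] by
     [v] by at most d / 4 more; the total is below [d]. *)
  destruct (archimed_cor1 (d / (4 * (L + 1)))) as [N [HN HN0]].
  { apply Rdiv_lt_0_compat; lra. }
  destruct (Hv (Rmin eps (d / 4)) N) as [n [Hn H]]; [apply Rmin_glb_lt; lra|].
  set (h := / INR (n + 1)) in *.
  assert (Hh : 0 <= h) by (left; apply Rinv_0_lt_compat, lt_0_INR; lia).
  assert (HLh : L * h <= d / 4).
  { assert (h <= d / (4 * (L + 1))).
    { apply Rle_trans with (2 := Rlt_le _ _ HN), Rinv_le_contravar.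
      - apply lt_0_INR; lia.
      - apply le_INR; lia. }
    replace (d / 4) with ((L + 1) * (d / (4 * (L + 1)))) by (field; lra).
    apply Rmult_le_compat; lra. }
  assert (HD : Rabs (dint (delayed_rhs A F h (u n)) t - dint (delayed_rhs A F 0 v) t)
    <= T * (T * (K * eps))).
  { apply dint_dist; try lra.
    1,2: apply delayed_rhs_continuous; trivial.
    - apply Rmult_le_pos; lra.
    - intros x Hx; unfold delayed_rhs.
      rewrite <- Rmult_minus_distr_l, Rabs_mult, (Rabs_pos_eq (A x)) by apply HK.
      apply Rmult_le_compat; [apply HK | apply Rabs_pos | apply HK|].
      left; apply HFd.
      replace (Rmax 0 (x - 0)) with x by (rewrite Rmax_right; lra).
      assert (H1 := Hlip n (Rmax 0 (x - h)) x).
      assert (H2 : L * Rabs (Rmax 0 (x - h) - x) <= L * h).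
      { apply Rmult_le_compat_l; [exact HL|].
        unfold Rmax; destruct Rle_dec; apply Rabs_le; lra. }
      assert (H3 := Rle_trans _ _ _ (H x Hx) (Rmin_r _ _)).
      apply Rle_trans with (1 := H1), Rabs_le_between in H2.
      apply Rabs_le_between in H3; apply Rabs_lt_between; lra. }
  assert (H1 := Rle_trans _ _ _ (H t Ht) (Rmin_l _ _)).
  assert (H2 := Rle_trans _ _ _ (H 0 ltac:(lra)) (Rmin_l _ _)).
  assert (H3 := Heq n t Ht); fold h in H3.
  apply Rabs_le_between in H1; apply Rabs_le_between in H2; apply Rabs_le_between in HD.
  apply Rabs_le_between; lra.
- apply Req_of_small_dist with (1 + alpha * eta); intros eps He.
  destruct (Hv eps O He) as [n [_ H]].
  assert (H1 := H T ltac:(lra)); assert (H2 := Hbc n).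
  assert (H3 : Rabs (RInt (u n) 0 eta - RInt v 0 eta) <= (eta - 0) * eps).
  { apply RInt_dist; auto; [lra|]; intros x Hx; apply H; lra. }
  apply Rabs_le_between in H1; apply Rabs_le_between in H3.
  apply Rabs_le_between; nra.
Qed.

(** * Growth conditions *)

Lemma zero_limit_small (f : R -> R) (e : R) :
  cont_on (fun x => 0 <= x) f -> f_zero_lim f (Finite 0) -> 0 < e ->
  exists c, 0 < c /\ forall x, 0 <= x <= c -> f x <= e * c.
Proof.
intros Hf Hlim He.
destruct (proj1 (filterlim_locally _ _) Hlim (mkposreal e He)) as [d Hd].
assert (Hpos : forall x, 0 < x < d -> f x <= e * x).
{ intros x Hx.
  assert (H : Rabs (f x / x - 0) < e).
  { apply (Hd x); [|lra]; change (Rabs (x - 0) < d); rewrite Rabs_pos_eq; lra. }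
  apply Rabs_lt_between in H.
  replace (f x) with (f x / x * x) by (field; lra).
  apply Rmult_le_compat_r; lra. }
assert (Hd0 := cond_pos d).
(* The limit at 0+ does not see f(0). Were f(0) larger, continuity would keep f above e * (d / 2) at
   small x > 0, against [Hpos]. *)
assert (H0 : f 0 <= e * (d / 2)).
{ apply Rnot_lt_le; intros Hlt.
  assert (Hgap : 0 < f 0 - e * (d / 2)) by lra.
  destruct (proj1 (filterlim_locally f (f 0)) (Hf 0 (Rle_refl 0)) (mkposreal _ Hgap))
    as [d' Hd'].
  assert (Hd0' := cond_pos d').
  set (x := Rmin (d / 2) (d' / 2)).
  assert (Hx : 0 < x) by (apply Rmin_glb_lt; lra).
  assert (Hx1 : x <= d / 2) by apply Rmin_l.
  assert (Hx2 : x <= d' / 2) by apply Rmin_r.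
  assert (H : Rabs (f x - f 0) < f 0 - e * (d / 2)).
  { apply (Hd' x); [|lra]; change (Rabs (x - 0) < d'); rewrite Rabs_pos_eq; lra. }
  apply Rabs_lt_between in H.
  assert (H1 := Hpos x ltac:(lra)).
  assert (e * x <= e * (d / 2)) by (apply Rmult_le_compat_l; lra).
  lra. }
exists (d / 2); split; [lra|]; intros x Hx.
destruct (Req_dec x 0) as [->|Hne]; [exact H0|].
apply Rle_trans with (1 := Hpos x ltac:(lra)), Rmult_le_compat_l; lra.
Qed.

Lemma inf_limit_small (f : R -> R) (e : R) :
  cont_on (fun x => 0 <= x) f -> f_inf_lim f (Finite 0) -> 0 < e ->
  exists c, 0 < c /\ forall x, 0 <= x <= c -> f x <= e * c.
Proof.
intros Hf Hlim He.
destruct (proj1 (filterlim_locally _ _) Hlim (mkposreal e He)) as [M HM].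
set (k := Rmax 1 M).
assert (Hk1 : 1 <= k) by apply Rmax_l.
assert (HkM : M <= k) by apply Rmax_r.
assert (Hcl : forall x, 0 <= clamp k x) by (intros; apply clamp_range; lra).
destruct (clamp_comp_bounded f k) as [B [HB0 HB]]; [lra| |].
{ apply (cont_on_comp _ f (clamp k) Hf Hcl), clamp_lip. }
(* Beyond [k] the limit gives f(x) <= e * x; on [0, k] the bound [B] is absorbed because c >= B /
   e. *)
exists (Rmax k (B / e)).
assert (Hc1 := Rmax_l k (B / e)); assert (Hc2 := Rmax_r k (B / e)).
split; [lra|]; intros x Hx.
destruct (Rle_dec x k) as [Hxk|Hxk].
- apply Rle_trans with B.
  + rewrite <- (clamp_id k x) by lra; apply HB.
  + replace B with (e * (B / e)) at 1 by (field; lra).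
    apply Rmult_le_compat_l; lra.
- assert (H : Rabs (f x / x - 0) < e) by (apply (HM x); lra).
  apply Rabs_lt_between in H.
  apply Rle_trans with (e * x); [|apply Rmult_le_compat_l; lra].
  replace (f x) with (f x / x * x) by (field; lra).
  apply Rmult_le_compat_r; lra.
Qed.

(** The smallest admissible x is g * c, so the threshold m / g for the ratio yields m * c. *)
Lemma ratio_large (f : R -> R) (g m c x : R) :
  0 < g -> 0 < c -> 0 < m -> g * c <= x -> m / g < f x / x -> m * c <= f x.
Proof.
intros Hg Hc Hm Hx H.
assert (H0 : 0 < g * c) by (apply Rmult_lt_0_compat; lra).
replace (f x) with (f x / x * x) by (field; lra).
replace (m * c) with (m / g * (g * c)) by (field; lra).
apply Rmult_le_compat; try lra.
left; apply Rdiv_lt_0_compat; lra.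
Qed.

Lemma zero_limit_large (f : R -> R) (g m : R) :
  f_zero_lim f p_infty -> 0 < g -> 0 < m ->
  exists c, 0 < c /\ forall x, g * c <= x <= c -> m * c <= f x.
Proof.
intros Hlim Hg Hm.
destruct (Hlim (fun y => m / g < y)) as [d Hd]; [exists (m / g); auto|].
assert (Hd0 := cond_pos d).
exists (d / 2); split; [lra|]; intros x Hx.
assert (H0 : 0 < g * (d / 2)) by (apply Rmult_lt_0_compat; lra).
apply ratio_large with g; try lra.
apply (Hd x); [|lra]; change (Rabs (x - 0) < d); rewrite Rabs_pos_eq; lra.
Qed.

Lemma inf_limit_large (f : R -> R) (g m : R) :
  f_inf_lim f p_infty -> 0 < g -> 0 < m ->
  exists c, 0 < c /\ forall x, g * c <= x <= c -> m * c <= f x.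
Proof.
intros Hlim Hg Hm.
destruct (Hlim (fun y => m / g < y)) as [M HM]; [exists (m / g); auto|].
set (k := Rmax 0 M).
assert (Hk1 : 0 <= k) by apply Rmax_l.
assert (HkM : M <= k) by apply Rmax_r.
(* Then g * c = k + 1 lies beyond [M], and so does the whole interval [g * c, c]. *)
exists ((k + 1) / g); split; [apply Rdiv_lt_0_compat; lra|]; intros x Hx.
apply ratio_large with g; try lra; [apply Rdiv_lt_0_compat; lra|].
apply (HM x).
replace (g * ((k + 1) / g)) with (k + 1) in Hx by (field; lra); lra.
Qed.

(** * Positivity of the weight and assembly of the solution *)

Lemma dint_pos (g : R -> R) (T t0 : R) :
  (forall x, continuous g x) -> (forall x, 0 <= g x) -> 0 < T -> 0 <= t0 <= T ->
  0 < g t0 -> 0 < dint g T.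
Proof.
intros Hg H0 HT Ht0 Hpos.
destruct (proj1 (continuous_eps g t0) (Hg t0) _ Hpos) as [d [Hd Hgd]].
set (r := Rmin (d / 2) (T / 4)).
assert (Hr0 : 0 < r) by (apply Rmin_glb_lt; lra).
assert (Hr1 : r <= d / 2) by apply Rmin_l.
assert (Hr2 : r <= T / 4) by apply Rmin_r.
(* An interval (p, p + r) near [t0] must end before T: the inner integral is positive only after g
   has contributed. So it is taken to the right of [t0] or to its left, according to the half of
   [0, T] containing [t0]. *)
assert (Hpq : exists p, 0 <= p /\ p + r < T /\ t0 - r <= p + r /\ p <= t0 /\ t0 - 2 * r <= p).
{ destruct (Rle_dec t0 (T / 2)).
  - exists t0; lra.
  - exists (t0 - 2 * r); lra. }
destruct Hpq as [p [Hp0 [HpT [Hp1 [Hp2 Hp3]]]]].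
assert (Hgp : forall x, p < x < p + r -> 0 < g x).
{ intros x Hx; assert (H : Rabs (g x - g t0) < g t0) by (apply Hgd, Rabs_lt_between; lra).
  apply Rabs_lt_between in H; lra. }
apply RInt_pos_subinterval with (p + r) T; try lra.
- apply RInt_cont_continuous, Hg.
- intros x Hx; apply RInt_ge_0; [lra | apply ex_RInt_cont, Hg | auto].
- intros x Hx; apply RInt_pos_subinterval with p (p + r); auto; lra.
Qed.

Theorem theorem3p1 (T eta alpha : R) (a f : R -> R)
  (hT : 0 < T) (heta : 0 < eta < T) (halpha : 0 < alpha < / eta)
  (hf_cont : cont_on (fun x => 0 <= x) f)
  (hf_nonneg : forall x, 0 <= x -> 0 <= f x)
  (ha_cont : cont_on (fun t => 0 <= t <= T) a)
  (ha_nonneg : forall t, 0 <= t <= T -> 0 <= a t)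
  (ha_pos : exists t0, 0 <= t0 <= T /\ 0 < a t0)
  (hlim : (f_zero_lim f (Finite 0) /\ f_inf_lim f p_infty) \/
          (f_zero_lim f p_infty /\ f_inf_lim f (Finite 0))) :
  exists u : R -> R, positive_solution T eta alpha a f u.
Proof.
assert (HclT : forall t, 0 <= clamp T t <= T) by (intros; apply clamp_range; lra).
set (A := fun t => a (clamp T t)).
assert (HA : forall t, continuous A t).
{ apply (cont_on_comp _ a (clamp T) ha_cont HclT), clamp_lip. }
destruct (clamp_comp_bounded a T (Rlt_le _ _ hT) HA) as [K [HK0 HK]].
assert (HAK : forall x, 0 <= A x <= K) by (intros x; split; [apply ha_nonneg, HclT | apply HK]).
assert (Hkappa : 0 < dint A T).
{ destruct ha_pos as [t0 [Ht0 Hp]].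
  apply dint_pos with t0; trivial; [apply HAK|].
  unfold A; rewrite clamp_id; trivial. }
assert (Hae := alpha_eta_bounds T eta alpha heta halpha).
(* Chosen so that e * [dint A T] is half of the allowed 1 - alpha * eta; likewise [m] below gives m
   * [dint A T] = 2 > 1. *)
set (e := (1 - alpha * eta) / (2 * dint A T)).
assert (He : 0 < e) by (apply Rdiv_lt_0_compat; lra).
set (m := 2 / dint A T).
assert (Hm : 0 < m) by (apply Rdiv_lt_0_compat; lra).
set (g := alpha * eta * (1 - eta / T)).
assert (Hg : 0 < g).
{ apply Rmult_lt_0_compat; [lra|].
  replace (1 - eta / T) with ((T - eta) / T) by (field; lra).
  apply Rdiv_lt_0_compat; lra. }
(* Cases (i) and (ii) differ only in which scale lies near 0 and which near infinity; from here on
   they are treated together. *)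
assert (Hc : (exists c, 0 < c /\ forall x, 0 <= x <= c -> f x <= e * c) /\
  (exists c, 0 < c /\ forall x, g * c <= x <= c -> m * c <= f x)).
{ destruct hlim as [[H0 Hi]|[H0 Hi]]; split.
  - apply zero_limit_small; trivial.
  - apply inf_limit_large; trivial.
  - apply inf_limit_small; trivial.
  - apply zero_limit_large; trivial. }
destruct Hc as [[c1 [Hc1 Hsmall]] [c2 [Hc2 Hlarge]]].
set (b := Rmax c1 c2).
assert (Hb1 : c1 <= b) by apply Rmax_l.
assert (Hb2 : c2 <= b) by apply Rmax_r.
assert (Hb : 0 <= b) by lra.
(* All shooting solutions take values in [0, b], so truncating [f] does not alter the equation,
   while [F] is bounded and uniformly continuous. *)
set (F := fun x => f (clamp b x)).
assert (HF : forall x, continuous F x).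
{ apply (cont_on_comp _ f (clamp b) hf_cont); [|apply clamp_lip].
  intros x; apply clamp_range, Hb. }
assert (HFu := clamp_comp_uniform_continuous f b Hb HF).
destruct (clamp_comp_bounded f b Hb HF) as [B [HB0 HB]].
assert (HFB : forall x, 0 <= F x <= B).
{ intros x; split; [apply hf_nonneg, clamp_range, Hb | apply HB]. }
assert (Happrox : forall n : nat, {u : R -> R |
    (forall t, 0 <= u t <= b) /\
    (forall s t, Rabs (u s - u t) <= K * B * T * Rabs (s - t)) /\
    Rmin c1 c2 <= u 0 /\
    (forall t, 0 <= t <= T ->
      u t = u 0 - dint (delayed_rhs A F (/ INR (n + 1)) u) t) /\
    u T = alpha * RInt u 0 eta}).
{ intros n; apply constructive_indefinite_description.
  apply shooting with (e := e) (m := m); trivial; try lra.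
  - apply Rinv_0_lt_compat, lt_0_INR; lia.
  (* Negative x are clamped to 0, which extends the bound to all x <= c1. *)
  - intros x Hx; apply Hsmall; unfold clamp, Rmax, Rmin; repeat destruct Rle_dec; lra.
  - replace (e * dint A T) with ((1 - alpha * eta) / 2) by (unfold e; field; lra); lra.
  - fold g; intros x Hx; unfold F; rewrite clamp_id; [apply Hlarge, Hx|].
    assert (0 < g * c2) by (apply Rmult_lt_0_compat; lra); lra.
  - replace (m * dint A T) with 2 by (unfold m; field; lra); lra. }
destruct (undelayed_solution A F T eta alpha K (K * B * T) b (Rmin c1 c2)
  (fun n => proj1_sig (Happrox n))) as [v [Hvc [Hvb [Hv0 [Hv HvT]]]]];
  trivial; try lra; try (intros n; apply (proj2_sig (Happrox n))).
{ apply Rmult_le_pos; [apply Rmult_le_pos|]; lra. }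
set (G := delayed_rhs A F 0 v) in *.
assert (HG : forall t, continuous G t) by (apply delayed_rhs_continuous; trivial).
(* [v] satisfies the integral equation only on [0, T], whereas [C2_on] asks for differentiability on
   R; this formula extends [v] from [0, T] to a twice differentiable function. *)
set (u := fun t => v 0 - dint G t).
assert (Huv : forall t, 0 <= t <= T -> u t = v t) by (intros t Ht; symmetry; apply Hv, Ht).
assert (Hu1 : forall t, is_derive u t (- RInt G 0 t)).
{ intros t; replace (- RInt G 0 t) with (minus 0 (RInt G 0 t))
    by (unfold minus, plus, opp; simpl; ring).
  apply (is_derive_minus (fun _ => v 0) (dint G)).
  - apply is_derive_Reals, derivable_pt_lim_const.
  - apply dint_derive, HG. }
assert (HDu : forall t, Derive u t = - RInt G 0 t) by (intros; apply is_derive_unique, Hu1).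
assert (Hu2 : forall t, is_derive (Derive u) t (- G t)).
{ intros t; apply is_derive_ext with (fun t => - RInt G 0 t).
  - intros s; symmetry; apply HDu.
  - apply (is_derive_opp (fun t => RInt G 0 t)), RInt_cont_derive, HG. }
assert (HDu2 : forall t, Derive_n u 2 t = - G t).
{ intros t; apply is_derive_unique, Hu2. }
assert (Hint : RInt u 0 eta = RInt v 0 eta).
{ apply RInt_ext; rewrite Rmin_left, Rmax_right by lra; intros; apply Huv; lra. }
exists u; split; [|split].
- split; [|split; [|split; [|split]]].
  + split; [|split].
    * intros t; exists (- RInt G 0 t); apply Hu1.
    * intros t _; exists (- G t); apply Hu2.
    * intros t _; apply filterlim_within_ext with (fun t => - G t).
      { intros s _; symmetry; apply HDu2. }
      rewrite HDu2; apply (filterlim_filter_le_1 _ (filter_le_within (F := locally t) _)).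
      apply (continuous_opp G), HG.
  (* On (0, T) both truncations and the zero delay disappear, since t is in [0, T] and v(t) in
     [0, b]. *)
  + intros t Ht; rewrite HDu2; unfold G, delayed_rhs, A, F.
    rewrite (Rmax_right 0 (t - 0)), Rminus_0_r by lra.
    rewrite (clamp_id T), (clamp_id b), Huv by (try apply Hvb; lra); ring.
  + rewrite HDu, (RInt_point 0 G); apply Ropp_0.
  + apply ex_RInt_cont; intros t; apply (ex_derive_continuous u); exists (- RInt G 0 t).
    apply Hu1.
  + rewrite Hint, Huv by lra; exact HvT.
- intros t Ht; rewrite Huv by exact Ht; apply Hvb, Ht.
- exists 0; split; [lra|]; rewrite Huv by lra.
  assert (0 < Rmin c1 c2) by (apply Rmin_glb_lt; lra); lra.
Qed.
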